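(* Let $P$ and $Q$ be two experimental designs, i.e. probability distributions on $\{0,1\}^n$, and suppose there is a constant $k_\tau$ such that $|\tau_i(\mathbf z)|\le k_\tau$ for all $i\in\{1,\dots,n\}$ and all $\mathbf z\in\{0,1\}^{n-1}$. Then $$\big|\tau_{P\text{-}EATE}-\tau_{Q\text{-}EATE}\big|\le 2k_\tau\,\delta(P,Q),$$ where $\delta(P,Q)=\sup_{A}|P(A)-Q(A)|$ is the total variation distance (supremum over all events $A\subseteq\{0,1\}^n$).
   Context: There are $n$ units with arbitrary potential outcome functions $y_i:\{0,1\}^n\to\mathbb R$, $i=1,\dots,n$. For $\mathbf z\in\{0,1\}^n$, $\mathbf z_{-i}\in\{0,1\}^{n-1}$ is $\mathbf z$ with its $i$th entry deleted, and $y_i(\mathbf z)$ is also written $y_i(z_i;\mathbf z_{-i})$. Define $\tau_i(\mathbf z_{-i})=y_i(1;\mathbf z_{-i})-y_i(0;\mathbf z_{-i})$ and $\tau_{ATE}(\mathbf z)=\frac1n\sum_{i=1}^n\tau_i(\mathbf z_{-i})$. The expected average treatment effects under the two designs are $\tau_{P\text{-}EATE}=E_P[\tau_{ATE}(\mathbf Z)]$ and $\tau_{Q\text{-}EATE}=E_Q[\tau_{ATE}(\mathbf Z)]$, where $\mathbf Z$ is distributed according to $P$ and $Q$, respectively. *)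

(* Defs.v *)
From HB Require Import structures.
From mathcomp Require Import all_boot all_order all_algebra.
From mathcomp Require Import all_classical all_reals all_analysis.

Set Implicit Arguments.
Unset Strict Implicit.
Unset Printing Implicit Defensive.

Import Order.TTheory GRing.Theory Num.Theory.

Local Open Scope classical_set_scope.
Local Open Scope ring_scope.

(* {0,1}^n with the discrete sigma-algebra: every subset is an event and a
   [probability (assignment n) R] is an arbitrary distribution on {0,1}^n. *)
Definition assignment (n : nat) : Type := {ffun 'I_n -> bool}.

HB.instance Definition _ n := Finite.on (assignment n).
HB.instance Definition _ n := isPointed.Build (assignment n) [ffun=> false].
HB.instance Definition _ n := @isMeasurable.Build default_measure_display
  (assignment n) discrete_measurable discrete_measurable0
  discrete_measurableC discrete_measurableU.

(* [del i z] is z_{-i}. *)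
Definition del n (i : 'I_n) (z : assignment n) : assignment n.-1 :=
  [ffun j => (z : {ffun 'I_n -> bool}) (lift i j)].

(* [ins i b w] is the assignment (z_i = b; z_{-i} = w). *)
Definition ins n (i : 'I_n) (b : bool) (w : assignment n.-1) : assignment n :=
  [ffun j => if unlift i j is Some k then (w : {ffun 'I_n.-1 -> bool}) k else b].

Section treatment_effects.
Variables (R : realType) (n : nat) (y : 'I_n -> assignment n -> R).

Definition tau (i : 'I_n) (w : assignment n.-1) : R :=
  y i (ins i true w) - y i (ins i false w).

Definition tau_ATE (z : assignment n) : R :=
  n%:R^-1 * \sum_(i < n) tau i (del i z).

Definition tau_EATE (P : probability (assignment n) R) : \bar R :=
  ('E_P[tau_ATE])%E.

End treatment_effects.

Definition tv_dist d (T : measurableType d) (R : realType)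
    (P Q : probability T R) : R :=
  sup [set `|fine (P A) - fine (Q A)| | A in @measurable d T].

(* Main.v *)
(* On a finite space the difference of expectations is [\sum_z f z (p z - q z)],
   hence at most [k \sum_z |p z - q z|]. Splitting the sum according to the sign
   of [p z - q z] writes it as the discrepancies of [P] and [Q] on an event and
   on its complement, each at most the total variation distance. *)
Require Import Defs.
From HB Require Import structures.
From mathcomp Require Import all_boot all_order all_algebra.
From mathcomp Require Import all_classical all_reals all_analysis.

Import Order.TTheory GRing.Theory Num.Theory.

Local Open Scope ring_scope.

(** The space is the finite disjoint union of its singletons, so the integral is additive over them,
    and on each singleton the integrand is constant. *)
Lemma integral_assignment (R : realType) (n : nat)
    (P : probability (assignment n) R) (f : assignment n -> R) :
  (\int[P]_z (f z)%:E)%E =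
  (\sum_(z : assignment n) f z * fine (P [set z]%classic))%:E.
Proof.
have defT : [set: assignment n]%classic
    = \big[setU/set0]_(z <- index_enum (assignment n)) [set z]%classic.
  by apply/seteqP; split=> // z _; rewrite -bigcup_seq; exists z => //=;
    rewrite mem_index_enum.
rewrite defT integral_bigsetU_EFin //; last 2 first.
- exact: index_enum_uniq.
- by move=> x y _ _ [z [-> ->]].
rewrite -sumEFin; apply: eq_bigr => z _.
rewrite (eq_integral (cst (f z)%:E)); last by move=> x; rewrite inE => ->.
by rewrite integral_cst // EFinM fineK // fin_num_measure.
Qed.

(** The probability of an event is the integral of its indicator, which [integral_assignment] turns
    into a finite sum. *)
Lemma probability_assignment (R : realType) (n : nat)
    (P : probability (assignment n) R) (a : pred (assignment n)) :
  fine (P [set` a]%classic) =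
  \sum_(z : assignment n | a z) fine (P [set z]%classic).
Proof.
have := integral_indic P measurableT (I : measurable [set` a]%classic).
rewrite setIT integral_assignment => <- /=.
rewrite [RHS]big_mkcond; apply: eq_bigr => z _ /=.
by rewrite indicE mem_setE unfold_in; case: (a z); rewrite ?mulr1 ?mul1r ?mul0r.
Qed.

(** A real [sup] is known to dominate its set only once the set is bounded above, so a bound has to
    be exhibited. *)
Lemma le_tv_dist d (T : measurableType d) (R : realType)
    (P Q : probability T R) (A : set T) :
  measurable A -> `|fine (P A) - fine (Q A)| <= tv_dist P Q.
Proof.
move=> mA; apply: ub_le_sup; last by exists A.
(* A crude bound suffices: each of the two probabilities has absolute value at most 1. *)
exists (1 + 1) => _ [B mB <-].
have prob1 (S : probability T R) : `|fine (S B)| <= 1.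
  by rewrite ger0_norm ?fine_ge0 // -lee_fin fineK ?fin_num_measure //
    probability_le1.
by apply: (le_trans (ler_normB _ _)); apply: lerD.
Qed.

Lemma sum_dist_le_tv_dist (R : realType) (n : nat)
    (P Q : probability (assignment n) R) :
  \sum_(z : assignment n)
    `|fine (P [set z]%classic) - fine (Q [set z]%classic)|
  <= 2 * tv_dist P Q.
Proof.
set p := fun z => fine (P [set z]%classic).
set q := fun z => fine (Q [set z]%classic).
have tv (a : pred (assignment n)) :
    `|\sum_(z : assignment n | a z) (p z - q z)| <= tv_dist P Q.
  by rewrite sumrB -!probability_assignment; exact: le_tv_dist.
rewrite mulr_natl mulr2n (bigID (fun z => q z <= p z)) /=; apply: lerD.
- apply: le_trans (tv (fun z => q z <= p z)); apply: le_trans (ler_norm _).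
  by apply: ler_sum => z qp; rewrite ger0_norm // subr_ge0.
- apply: le_trans (tv (fun z => ~~ (q z <= p z))).
  (* On this event every [p z - q z] is negative, so the sign is flipped inside the norm to make the
     summands equal to their absolute values. *)
  rewrite -[leRHS]normrN -sumrN; apply: le_trans (ler_norm _).
  apply: ler_sum => z; rewrite -ltNge => pq.
  by rewrite ltr0_norm // subr_lt0.
Qed.

Lemma expectation_dist_le (R : realType) (n : nat)
    (P Q : probability (assignment n) R) (f : assignment n -> R) (k : R) :
  (forall z, `|f z| <= k) ->
  (`|'E_P[f] - 'E_Q[f]| <= (2 * k * tv_dist P Q)%:E)%E.
Proof.
move=> fk; rewrite unlock !integral_assignment -EFinB abse_EFin lee_fin -sumrB.
(* The sign of [k] comes from the bound at any one assignment; [point] supplies one. *)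
have k0 : 0 <= k by exact: (le_trans (normr_ge0 (f point)) (fk point)).
apply: (le_trans (ler_norm_sum _ _ _)).
rewrite (mulrC 2) -mulrA.
apply: le_trans (ler_wpM2l k0 (sum_dist_le_tv_dist _ _ P Q)).
rewrite mulr_sumr; apply: ler_sum => z _.
by rewrite -mulrBr normrM ler_wpM2r.
Qed.

(** An average of [n] terms inherits their common bound; [n_gt0] allows multiplying through by
    [n]. *)
Lemma tau_ATE_le (R : realType) (n : nat) (n_gt0 : (0 < n)%N)
    (y : 'I_n -> assignment n -> R) (k : R) (z : assignment n) :
  (forall i w, `|tau y i w| <= k) -> `|tau_ATE y z| <= k.
Proof.
move=> tauk; have n0 : 0 < n%:R :> R by rewrite ltr0n.
rewrite /tau_ATE normrM normfV normr_nat mulrC ler_pdivrMr //.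
apply: (le_trans (ler_norm_sum _ _ _)).
(* The product of [k] and [n] is rewritten as a constant sum over ['I_n], to compare term by
   term. *)
rewrite mulr_natr -[X in _ *+ X]card_ord -sumr_const.
by apply: ler_sum.
Qed.

Theorem proposition12 (R : realType) (n : nat) (n_gt0 : (0 < n)%N)
    (y : 'I_n -> assignment n -> R)
    (P Q : probability (assignment n) R) (k : R)
    (tau_bounded : forall (i : 'I_n) (w : assignment n.-1),
       `|tau y i w| <= k) :
  (`|tau_EATE y P - tau_EATE y Q| <= (2 * k * tv_dist P Q)%:E)%E.
Proof.
by apply: expectation_dist_le => z; exact: tau_ATE_le.
Qed.
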